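(* Let ${\mathbf X}\in\mathbb{R}^{n\times p}$ be a deterministic design matrix, $\theta_0\in\mathbb{R}^p$, $S=\mathrm{supp}(\theta_0)$, $s_0=|S|$, and $Y={\mathbf X}\theta_0+W$ with $W\sim\mathsf{N}(0,\sigma^2 I_{n\times n})$. Let $\widehat\Sigma={\mathbf X}^{\sf T}{\mathbf X}/n$ with $\widehat\Sigma_{i,i}\le1$ for all $i\in[p]$. Let $T_0,v_0$ be as in the context. Assume: (i) $\sigma_{\min}(\widehat\Sigma_{T_0,T_0})\ge C_{\min}>0$; (ii) $\|\widehat\Sigma_{T_0^c,T_0}\widehat\Sigma_{T_0,T_0}^{-1}v_{0,T_0}\|_\infty\le1-\eta$ for some $\eta>0$; $\lambda=\frac{\sigma}{\eta}\sqrt{\frac{2c_1\log p}{n}}$ with a constant $c_1>1$; (iii) for some $c_2>0$, $|\theta_{0,i}|\ge c_2\lambda+\lambda|[\widehat\Sigma_{T_0,T_0}^{-1}v_{0,T_0}]_i|$ for all $i\in S$ and $|[\widehat\Sigma_{T_0,T_0}^{-1}v_{0,T_0}]_i|\ge c_2$ for all $i\in T_0\setminus S$; and $\eta\le c_2\sqrt{C_{\min}}$. Let $\widehat\theta^{\mathrm{GL}}$ and $\widehat S$ be the Gauss-Lasso estimator and selected model computed with this $\lambda$. Then for every $\mu>0$, $$\mathbb{P}\big(\|\widehat\theta^{\mathrm{GL}}-\theta_0\|_\infty\ge\mu\big)\le4p^{1-c_1}+2p\,e^{-nC_{\min}\mu^2/(2\sigma^2)},$$ and $$\mathbb{P}(\widehat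 S=S)\ge1-6p^{1-c_1/4}.$$
   Context: The Lasso estimator $\widehat\theta^n(\lambda)$ minimizes $\frac{1}{2n}\|Y-{\mathbf X}\theta\|_2^2+\lambda\|\theta\|_1$. Gauss-Lasso: let $T=\mathrm{supp}(\widehat\theta^n)$; set $\widehat\theta^{\mathrm{GL}}_T=({\mathbf X}_T^{\sf T}{\mathbf X}_T)^{-1}{\mathbf X}_T^{\sf T}Y$ and $\widehat\theta^{\mathrm{GL}}_{T^c}=0$ (${\mathbf X}_T$ = columns of ${\mathbf X}$ in $T$); with $\widehat\theta^{\mathrm{GL}}_{(s_0)}$ the $s_0$-th largest entry in modulus, $\widehat S=\{i\in[p]:|\widehat\theta^{\mathrm{GL}}_i|\ge|\widehat\theta^{\mathrm{GL}}_{(s_0)}|\}$. For $\xi>0$, $\widehat\theta^{\mathrm{ZN}}(\xi)$ is a minimizer of $\frac12\langle\theta-\theta_0,\widehat\Sigma(\theta-\theta_0)\rangle+\xi\|\theta\|_1$; there exist $\xi_0>0$, $T_0\subseteq[p]$, $v_0\in\{-1,0,+1\}^p$ with $\mathrm{sign}(\widehat\theta^{\mathrm{ZN}}(\xi))=v_0$ and $\mathrm{supp}(\widehat\theta^{\mathrm{ZN}}(\xi))=\mathrm{supp}(v_0)=T_0$ for all $\xi\in(0,\xi_0)$, and $T_0\supseteq S$, $v_{0,S}=\mathrm{sign}(\theta_{0,S})$. $\mathrm{sign}(u)_i=+1,0,-1$ according as $u_i>0,=0,<0$; $A_{I,J}$ submatrix, $A_{I,I}^{-1}=(A_{I,I})^{-1}$,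 $T^c=[p]\setminus T$, $\sigma_{\min}$ minimum singular value. *)

(* Defs.v *)
From HB Require Import structures.
From mathcomp Require Import all_boot all_order all_algebra.
From mathcomp Require Import all_classical all_reals.
From mathcomp Require Import ereal topology normedtype sequences exp measure
  lebesgue_measure lebesgue_integral probability normal_distribution.
Set Implicit Arguments. Unset Strict Implicit. Unset Printing Implicit Defensive.
Import Order.TTheory GRing.Theory Num.Theory.
Local Open Scope classical_set_scope.
Local Open Scope ring_scope.

Section Defs.
Context {R : realType}.

Definition norm1 k (u : 'cV[R]_k) : R := \sum_i `|u i 0|.
Definition norm2 k (u : 'cV[R]_k) : R := Num.sqrt (\sum_i u i 0 ^+ 2).
Definition norminf k (u : 'cV[R]_k) : R := \big[Num.max/0]_i `|u i 0|.

Definition supp p (u : 'cV[R]_p) : {set 'I_p} := [set i | u i 0 != 0].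
Definition sgnv p (u : 'cV[R]_p) : 'cV[R]_p := \col_i Num.sg (u i 0).

Definition colsT n p (T : {set 'I_p}) (X : 'M[R]_(n, p)) : 'M[R]_(n, #|T|) :=
  \matrix_(i, j) X i (enum_val j).
Definition subm p (T1 T2 : {set 'I_p}) (A : 'M[R]_p) : 'M[R]_(#|T1|, #|T2|) :=
  \matrix_(i, j) A (enum_val i) (enum_val j).
Definition subv p (T : {set 'I_p}) (u : 'cV[R]_p) : 'cV[R]_#|T| :=
  \col_j u (enum_val j) 0.
Definition extv p (T : {set 'I_p}) (u : 'cV[R]_#|T|) : 'cV[R]_p :=
  \col_i \sum_(k < #|T|) (if enum_val k == i then u k 0 else 0).

Definition Sigmahat n p (X : 'M[R]_(n, p)) : 'M[R]_p :=
  (n%:R)^-1 *: (X^T *m X).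

(* minimum singular value of a square matrix (+oo for a 0x0 matrix) *)
Definition sigma_min k (A : 'M[R]_k) : \bar R :=
  ereal_inf [set (norm2 (A *m u))%:E | u in [set u : 'cV[R]_k | norm2 u = 1]].

Definition lasso_obj n p (X : 'M[R]_(n, p)) (Y : 'cV[R]_n) (lam : R)
  (th : 'cV[R]_p) : R :=
  (2 * n%:R)^-1 * norm2 (Y - X *m th) ^+ 2 + lam * norm1 th.
Definition is_lasso n p (X : 'M[R]_(n, p)) (Y : 'cV[R]_n) (lam : R)
  (th : 'cV[R]_p) : Prop :=
  forall th', lasso_obj X Y lam th <= lasso_obj X Y lam th'.

Definition gauss_lasso n p (X : 'M[R]_(n, p)) (Y : 'cV[R]_n)
  (thL : 'cV[R]_p) : 'cV[R]_p :=
  let XT := colsT (supp thL) X in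
  @extv p (supp thL) (invmx (XT^T *m XT) *m XT^T *m Y).

Definition kth_largest p (u : 'cV[R]_p) (s : nat) : R :=
  nth 0 (sort (fun x y : R => y <= x) [seq `|u i 0| | i <- enum 'I_p]) s.-1.
(* selected model; for s = 0 we use the convention |u_(0)| = +oo, i.e. empty *)
Definition Shat p (u : 'cV[R]_p) (s : nat) : {set 'I_p} :=
  [set i | (0 < s)%N && (kth_largest u s <= `|u i 0|)].

Definition zn_obj p (Sig : 'M[R]_p) (theta0 : 'cV[R]_p) (xi : R)
  (th : 'cV[R]_p) : R :=
  2^-1 * ((th - theta0)^T *m Sig *m (th - theta0)) 0 0 + xi * norm1 th.
Definition is_zn_min p (Sig : 'M[R]_p) (theta0 : 'cV[R]_p) (xi : R)
  (th : 'cV[R]_p) : Prop :=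
  forall th', zn_obj Sig theta0 xi th <= zn_obj Sig theta0 xi th'.

(* W ~ N(0, sigma^2 I_n): i.i.d. N(0, sigma^2) coordinates *)
Definition gaussian_noise d (Omega : measurableType d) (P : probability Omega R)
  n (W : Omega -> 'cV[R]_n) (sigma : R) : Prop :=
  (forall i, measurable_fun setT (fun w => W w i 0)) /\
  (forall i (B : set R), measurable B ->
      P [set w | B (W w i ord0)] = normal_prob 0 sigma B) /\
  (forall B : 'I_n -> set R, (forall i, measurable (B i)) ->
      P [set w | forall i, B i (W w i ord0)] =
      (\prod_(i < n) P [set w | B i (W w i ord0)])%E).

End Defs.
Arguments extv {R p} T u.
Arguments subv {R p} T u.
Arguments subm {R p} T1 T2 A.
Arguments colsT {R n p} T X.

(* Main.v *)
(* Write Sigma = X^T X / n, let K W be the least squares fit of the noise on the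
   columns in T0 (padded with zeros) and w = Sigma_{T0,T0}^-1 v0 (padded likewise).
   The stationarity conditions of the zero-noise problem give theta^ZN(xi) = theta0
   - xi w for small xi, so outside the support of theta0 the sign v0 is minus that
   of w. When |K W| < c2 lam entrywise, t = theta0 - lam w + K W therefore has sign
   v0; when moreover the residual correlations |X^T (1 - P) W / n| are below eta
   lam, t satisfies the optimality conditions of the Lasso with strict inequality
   off T0, which forces every minimizer to equal t. On that event the Gauss-Lasso
   estimator is theta0 + K W, and it separates the true support from the rest as
   soon as |K W| < c2 lam / 2.

   The entries of K W and X^T (1 - P) W / n are centred Gaussians of variance at most
   sigma^2 / (n Cmin) and sigma^2 / n, so both bounds follow from Chernoff's
   inequality and a union bound. For p = 1 one has lam = 0 and both bounds are
   vacuous. *)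
Require Import Defs.
From HB Require Import structures.
From mathcomp Require Import all_boot all_order all_algebra.
From mathcomp Require Import all_classical all_reals.
From mathcomp Require Import ereal topology normedtype sequences exp measure
  lebesgue_measure lebesgue_integral probability normal_distribution.
From mathcomp Require Import measurable_realfun numfun ring lra.
Set Implicit Arguments. Unset Strict Implicit. Unset Printing Implicit Defensive.
Import Order.TTheory GRing.Theory Num.Theory.
Local Open Scope classical_set_scope.
Local Open Scope ring_scope.

(** * Integration against a density along a measurable map *)

Section weighted.
Context d d' (T : measurableType d) (U : measurableType d') (R : realType).
Variables (mu : {measure set T -> \bar R}) (nu : {measure set U -> \bar R}).
Variables (Y : T -> U) (G : T -> R).
Hypotheses (mY : measurable_fun setT Y) (mG : measurable_fun setT G).
Hypothesis G0 : forall x, 0 <= G x.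
Hypothesis GY : forall B, measurable B ->
  (\int[mu]_x ((\1_B (Y x))%:E * (G x)%:E) = nu B)%E.

Import HBNNSimple.
Local Open Scope ereal_scope.

Let mGE : measurable_fun setT (EFin \o G). Proof. exact/measurable_EFinP. Qed.

(** [GY] is the case of indicators; linearity extends it to simple functions and monotone
    convergence to every nonnegative measurable [f]. *)
Lemma ge0_integral_weighted_pushforward (f : U -> \bar R) :
  (forall y, 0 <= f y) -> measurable_fun setT f ->
  \int[mu]_x (f (Y x) * (G x)%:E) = \int[nu]_y f y.
Proof.
move=> f0 mf; pose h := nnsfun_approx measurableT mf.
have cvh y : (EFin \o h n) y @[n --> \oo] --> f y by exact: cvg_nnsfun_approx.
have ndh y : {homo (fun n => h n y) : a b / (a <= b)%N >-> (a <= b)%R}.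
  by move=> a b ab; exact/lefP/nd_nnsfun_approx.
have mhY n : measurable_fun setT (fun x => (h n (Y x))%:E).
  by apply/measurable_EFinP; exact: measurableT_comp.
have -> : \int[nu]_y f y = lim (\int[nu]_y (EFin \o h n) y @[n --> \oo]).
  under eq_integral => y _ do rewrite -(cvg_lim _ (cvh y))//.
  apply: monotone_convergence => //.
  - by move=> n; exact/measurable_EFinP.
  - by move=> n x _ /=; rewrite lee_fin.
  - by move=> x _ a b ab; rewrite lee_fin ndh.
have -> : \int[mu]_x (f (Y x) * (G x)%:E) =
    lim (\int[mu]_x ((h n (Y x))%:E * (G x)%:E) @[n --> \oo]).
  have fg x : f (Y x) * (G x)%:E = lim ((h n (Y x))%:E * (G x)%:E @[n --> \oo]).
    apply/esym/cvg_lim => //.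
    by apply: cvgeZr => //; exact: cvh.
  under eq_integral => x _ do rewrite fg.
  apply: monotone_convergence => //.
  - by move=> n; apply: emeasurable_funM.
  - by move=> n x _ /=; rewrite mule_ge0 ?lee_fin.
  - by move=> x _ a b ab/=; rewrite lee_wpmul2r ?lee_fin ?ndh.
congr (lim (_ @[n --> \oo])); apply/funext => n.
(* Splitting the simple function over its level sets turns both sides into finite sums, which [GY]
   matches term by term. *)
transitivity (\int[mu]_x (\sum_(r \in range (h n))
    (r%:E * ((\1_(h n @^-1` [set r]) (Y x))%:E * (G x)%:E)))).
  apply: eq_integral => x _; rewrite (fimfunE (h n) (Y x)) -fsumEFin//.
  rewrite ge0_mule_fsuml => [|r]; last exact: nnfun_muleindic_ge0.
  by apply: eq_fsbigr => r _; rewrite EFinM muleA.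
transitivity (\int[nu]_y (\sum_(r \in range (h n))
    (r * \1_(h n @^-1` [set r]) y)%:E)); last first.
  by apply: eq_integral => t tE; rewrite /= fimfunE -fsumEFin.
have mI r : measurable_fun setT (fun x => (\1_(h n @^-1` [set r]) (Y x))%:E * (G x)%:E).
  apply: emeasurable_funM => //; apply/measurable_EFinP.
  by apply: (measurableT_comp _ mY); exact: measurable_indic.
rewrite [LHS]ge0_integral_fsum//; last 2 first.
- by move=> r; apply: emeasurable_funM.
- move=> r x _; rewrite -!EFinM lee_fin mulrA mulr_ge0// -lee_fin.
  exact: nnfun_muleindic_ge0.
rewrite ge0_integral_fsum//; last 2 first.
- by move=> r; apply/measurable_EFinP; exact: measurable_funM.
- by move=> r y _; exact: nnfun_muleindic_ge0.
apply: eq_fsbigr => r; rewrite inE => -[t _ <-].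
rewrite ge0_integralZl//; last 2 first.
- by move=> x _; rewrite mule_ge0 ?lee_fin.
- by rewrite lee_fin.
rewrite GY//; under [RHS]eq_integral do rewrite EFinM.
rewrite ge0_integralZl//; last 2 first.
- by apply: measurableT_comp => //; exact: measurable_indic.
- by rewrite lee_fin.
by rewrite integral_indic// setIT.
Qed.

End weighted.

(** * Moment generating function of the normal law *)

Section gaussian.
Context {R : realType}.

Lemma integral_normal_prob_ge0 (m s : R) (f : R -> \bar R) :
  (forall x, 0 <= f x)%E -> measurable_fun setT f ->
  (\int[normal_prob m s]_x f x =
   \int[lebesgue_measure]_x (f x * (normal_pdf m s x)%:E))%E.
Proof.
move=> f0 mf; symmetry.
apply: (@ge0_integral_weighted_pushforward _ _ _ _ R lebesgue_measure
  (normal_prob m s) idfun (normal_pdf m s)) => //=.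
- exact: measurable_id.
- exact: measurable_normal_pdf.
- by move=> x; exact: normal_pdf_ge0.
move=> B mB; rewrite /normal_prob [RHS]integral_mkcond.
by apply: eq_integral => x _; rewrite muleC epatch_indic.
Qed.

(** Completing the square: the exponential times the centred density is a constant times the density
    of mean [s ^+ 2 * t], which integrates to 1. *)
Lemma normal_mgf (s t : R) : s != 0 ->
  (\int[normal_prob 0 s]_x (expR (t * x))%:E = (expR (s ^+ 2 * t ^+ 2 / 2))%:E)%E.
Proof.
move=> s0; rewrite integral_normal_prob_ge0; last 2 first.
- by move=> x; rewrite lee_fin expR_ge0.
- apply/measurable_EFinP; apply: measurableT_comp => //; exact: mulrl_measurable.
transitivity (\int[lebesgue_measure]_x
    ((expR (s ^+ 2 * t ^+ 2 / 2))%:E * (normal_pdf (s ^+ 2 * t) s x)%:E))%E.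
  apply: eq_integral => x _; rewrite -!EFinM !normal_pdfE//.
  rewrite -[in LHS]/(normal_peak s * normal_fun 0 s x).
  rewrite -[in RHS]/(normal_peak s * normal_fun (s ^+ 2 * t) s x).
  rewrite mulrCA [in RHS]mulrCA /normal_fun -!expRD.
  by congr (_ * expR _)%:E; field.
rewrite ge0_integralZl//; last 2 first.
- by apply/measurable_EFinP; exact: measurable_normal_pdf.
- by move=> x _; rewrite lee_fin normal_pdf_ge0.
by rewrite integral_normal_pdf mule1.
Qed.

End gaussian.

(** * Expectations of products of independent variables *)

Section independent_product.
Context d (Omega : measurableType d) (R : realType) (P : probability Omega R).
Variables (n : nat) (W : 'I_n -> Omega -> R).
Variable Q : probability (measurableTypeR R) R.
Hypothesis mW : forall i, measurable_fun setT (W i).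
Hypothesis indep : forall B : 'I_n -> set R, (forall i, measurable (B i)) ->
  P [set w | forall i, B i (W i w)] = (\prod_(i < n) Q (B i))%E.

(* Only the first [k] factors are arbitrary, the others are indicators: the case [k = 0] is
   the hypothesis, and one more factor is freed by viewing the product of the others
   as a density. *)
Lemma integral_indep_prod_indic (k : nat) (f : 'I_n -> R -> R) (c : 'I_n -> R) :
  (forall i x, 0 <= f i x) -> (forall i, measurable_fun setT (f i)) ->
  (forall i, \int[Q]_x (f i x)%:E = (c i)%:E)%E ->
  (forall i : 'I_n, (k <= i)%N -> exists2 B, measurable B & f i = \1_B) ->
  (\int[P]_w (\prod_i f i (W i w))%:E = (\prod_i c i)%:E)%E.
Proof.
elim: k f c => [|k IH] f c f0 mf fc fB.
  have [B mB fE] : exists2 B : 'I_n -> set R, forall i, measurable (B i) &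
      forall i, f i = \1_(B i).
    have /choice[B HB] : forall i, exists B, measurable B /\ f i = \1_B.
      by move=> i; have [B] := fB i isT; exists B.
    by exists B => i; have [] := HB i.
  have cE i : (c i)%:E = Q (B i).
    by rewrite -fc fE integral_indic ?setIT//; exact: mB.
  rewrite -prodEFin; under [RHS]eq_bigr do rewrite cE.
  rewrite -indep//.
  have mA : measurable [set w | forall i, B i (W i w)].
    rewrite [X in measurable X](_ : _ = \bigcap_(i in [set: 'I_n]) (W i @^-1` B i)).
      apply: fin_bigcap_measurable => // i _.
      by rewrite -[X in measurable X]setTI; exact: mW.
    by apply/seteqP; split=> w /= H i; [move=> _; exact: H|exact: H].
  rewrite -[X in _ = P X]setIT -integral_indic//.
  apply: eq_integral => w _; congr EFin; under eq_bigr do rewrite fE indicE.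
  rewrite indicE; case: (boolP (w \in _)); rewrite ?inE /= => H.
    by apply: big1 => i _; rewrite mem_set.
  have [i /negP Hi] : exists i, ~~ (W i w \in B i).
    apply/not_existsP => H'; apply: (negP H); rewrite inE => i.
    by have /negP/negPn := H' i; rewrite inE.
  by rewrite (bigD1 i)//= (negPf (introN idP Hi)) mul0r.
(* When [n <= k] no index is at least [k], so the indicator condition of the induction hypothesis is
   void. *)
case: (ltnP k n) => [kn|nk]; last first.
  by apply: IH => // i ki; have := leq_trans nk ki; rewrite leqNgt ltn_ord.
pose i0 := Ordinal kn.
have prod0 (I : finType) (p : pred I) (F : I -> R) : (forall i, 0 <= F i) ->
    0 <= \prod_(i | p i) F i by move=> F0; apply: prodr_ge0 => i _.
have c0 i : 0 <= c i.
  by rewrite -lee_fin -fc integral_ge0// => x _; rewrite lee_fin.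
have C0 : 0 <= \prod_(i | i != i0) c i by exact: prod0.
under eq_integral do rewrite (bigD1 i0)//= EFinM.
(* The product of the other factors is the weight; its image under [W i0] is [Q] scaled by the
   product of their expectations. *)
rewrite (@ge0_integral_weighted_pushforward _ _ _ _ _ _ (mscale (NngNum C0) Q) _ _
  (mW i0) _ _ _ (fun x => (f i0 x)%:E)); last 5 first.
- under eq_fun do rewrite -big_filter.
  by apply: measurable_prod => i _; exact: measurableT_comp.
- by move=> w; exact: prod0.
- move=> B mB.
  (* On [B] this is the induction hypothesis for the family with factor [i0] replaced by an
     indicator. *)
  pose f' i := if i == i0 then \1_B else f i.
  pose c' i := if i == i0 then fine (Q B) else c i.
  have c'0 : c' i0 = fine (Q B) by rewrite /c' eqxx.
  have f'0 : f' i0 = \1_B by rewrite /f' eqxx.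
  rewrite -[RHS]/((\prod_(i < n | i != i0) c i)%:E * Q B)%E.
  have := IH f' c'; rewrite (bigD1 i0)//= c'0.
  have -> : \prod_(i < n | i != i0) c' i = \prod_(i < n | i != i0) c i.
    by apply: eq_bigr => i /negPf; rewrite /c' => ->.
  rewrite EFinM fineK ?fin_num_measure// muleC => <-.
  + apply: eq_integral => w _; rewrite [in RHS](bigD1 i0)//= EFinM f'0.
    congr (_ * _%:E)%E; apply: eq_bigr => i /negPf; rewrite /f' => ->.
    by [].
  + by move=> i x; rewrite /f'; case: eqP.
  + by move=> i; rewrite /f'; case: eqP => // _; exact: measurable_indic.
  + move=> i; rewrite /f' /c'; case: eqP => // _.
    by rewrite integral_indic// setIT fineK ?fin_num_measure.
  + move=> i ki; rewrite /f'; case: eqP => [_|/eqP ii0]; first by exists B.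
    by apply: fB; rewrite ltn_neqAle ki andbT; apply: contraNneq ii0 => ik; apply/eqP/val_inj.
- by move=> y; rewrite lee_fin.
- by apply/measurable_EFinP; exact: mf.
rewrite ge0_integral_mscale//=; last first.
- by move=> y _; rewrite lee_fin.
- by apply/measurable_EFinP; exact: mf.
by rewrite fc [in RHS](bigD1 i0)//= mulrC EFinM muleC.
Qed.

Lemma integral_indep_prod (f : 'I_n -> R -> R) (c : 'I_n -> R) :
  (forall i x, 0 <= f i x) -> (forall i, measurable_fun setT (f i)) ->
  (forall i, \int[Q]_x (f i x)%:E = (c i)%:E)%E ->
  (\int[P]_w (\prod_i f i (W i w))%:E = (\prod_i c i)%:E)%E.
Proof.
move=> f0 mf fc; apply: (@integral_indep_prod_indic n f c) => // i.
by rewrite leqNgt ltn_ord.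
Qed.

End independent_product.

(** * Gaussian tail and union bounds *)

Section gaussian_tail.
Context d (Omega : measurableType d) (R : realType) (P : probability Omega R).
Variables (n : nat) (W : Omega -> 'cV[R]_n) (s : R).
Hypotheses (s0 : 0 < s) (noiseW : gaussian_noise P W s).

Lemma measurable_noise_comb m (a : 'M[R]_(m, n)) i :
  measurable_fun setT (fun w => (a *m W w) i 0).
Proof.
case: noiseW => mW _; under eq_fun do rewrite mxE.
by apply: measurable_sum => j; exact: measurable_funM.
Qed.

Lemma measurable_noise_ge m (a : 'M[R]_(m, n)) i (t : R) :
  measurable [set w | t <= `|(a *m W w) i 0|].
Proof.
rewrite -[X in measurable X]setTI; apply: measurable_fun_le => //.
exact/measurableT_comp/measurable_noise_comb.
Qed.

Lemma gaussian_noise_mgf (a : 'rV[R]_n) :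
  (\int[P]_w (expR ((a *m W w) 0 0))%:E =
   (expR (s ^+ 2 * (\sum_j a 0 j ^+ 2) / 2))%:E)%E.
Proof.
case: noiseW => mW [lawW indW].
transitivity (\int[P]_w (\prod_j expR (a 0 j * W w j 0))%:E)%E.
  by apply: eq_integral => w _; rewrite mxE expR_sum.
rewrite (@integral_indep_prod _ _ _ P n (fun i w => W w i 0) (normal_prob 0 s) mW _
  (fun j x => expR (a 0 j * x)) (fun j => expR (s ^+ 2 * a 0 j ^+ 2 / 2))).
- by rewrite -expR_sum mulr_sumr mulr_suml.
- by move=> B mB; rewrite indW//; apply: eq_bigr => i _; exact: lawW.
- by move=> i x; exact: expR_ge0.
- by move=> i; apply: measurableT_comp => //; exact: mulrl_measurable.
- by move=> i; apply: normal_mgf; rewrite gt_eqF.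
Qed.

Lemma gaussian_noise_tail1 (a : 'rV[R]_n) (v t : R) :
  0 < v -> 0 < t -> \sum_j a 0 j ^+ 2 <= v ->
  (P [set w | t <= (a *m W w) ord0 ord0]%R <= (expR (- t ^+ 2 / (2 * s ^+ 2 * v)))%:E)%E.
Proof.
move=> v0 t0 av.
have sv : 0 < s ^+ 2 * v by rewrite mulr_gt0// exprn_gt0.
(* Minimizer of [s ^+ 2 * r ^+ 2 * v / 2 - r * t], the Chernoff exponent once the squared norm of
   [a] is bounded by [v]. *)
pose r := t / (s ^+ 2 * v).
have r0 : 0 < r by rewrite divr_gt0.
have mX := @measurable_noise_comb 1 a ord0.
pose X : {RV P >-> R} := HB.pack (fun w => (a *m W w) 0 0)
  (isMeasurableFun.Build _ _ _ _ _ mX).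
apply: le_trans (chernoff X t r0) _.
have -> : ('M_P X r = (expR (s ^+ 2 * (\sum_j (r *: a) 0 j ^+ 2) / 2))%:E)%E.
  rewrite /mmt_gen_fun unlock -gaussian_noise_mgf; apply: eq_integral => w _ /=.
  by rewrite -scalemxAl [in RHS]mxE mulrC.
rewrite -EFinM lee_fin -expRD ler_expR.
have -> : \sum_j (r *: a) 0 j ^+ 2 = r ^+ 2 * \sum_j a 0 j ^+ 2.
  by rewrite mulr_sumr; apply: eq_bigr => j _; rewrite mxE exprMn.
apply: (@le_trans _ _ (s ^+ 2 * (r ^+ 2 * v) / 2 - r * t)).
  by rewrite lerD2r ler_pM2r ?invr_gt0// ler_pM2l ?exprn_gt0// ler_pM2l ?exprn_gt0.
by rewrite le_eqVlt; apply/orP; left; apply/eqP; rewrite /r; field; rewrite !gt_eqF.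
Qed.

Lemma gaussian_noise_tail (a : 'rV[R]_n) (v t : R) :
  0 < v -> 0 < t -> \sum_j a 0 j ^+ 2 <= v ->
  (P [set w | t <= `|(a *m W w) ord0 ord0|]%R <=
   (2 * expR (- t ^+ 2 / (2 * s ^+ 2 * v)))%:E)%E.
Proof.
move=> v0 t0 av.
have mge (b : 'rV[R]_n) : measurable [set w | t <= (b *m W w) ord0 ord0].
  rewrite -[X in measurable X]setTI; apply: measurable_fun_le => //.
  exact: measurable_noise_comb.
rewrite (_ : [set w | _] = [set w | t <= (a *m W w) ord0 ord0] `|`
  [set w | t <= ((- a) *m W w) ord0 ord0]); last first.
  apply/seteqP; split => w /=; rewrite mulNmx [in X in _ \/ X]mxE ler_normr; move/orP => //.
apply: (le_trans (measureU2 _ (mge a) (mge (- a)))).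
rewrite mulr_natl mulr2n EFinD; apply: leeD; first exact: gaussian_noise_tail1.
apply: gaussian_noise_tail1 => //.
by under eq_bigr do rewrite mxE sqrrN.
Qed.

Lemma gaussian_noise_union m (a : 'M[R]_(m, n)) (v t : R) :
  0 < v -> 0 < t -> (forall i, \sum_j a i j ^+ 2 <= v) ->
  measurable [set w | exists i, t <= `|(a *m W w) i 0|] /\
  (P [set w | exists i, t <= `|(a *m W w) i 0|]%R <=
   (m%:R * (2 * expR (- t ^+ 2 / (2 * s ^+ 2 * v))))%:E)%E.
Proof.
move=> v0 t0 av; pose F i := [set w | t <= `|(a *m W w) i 0|].
have -> : [set w | exists i, t <= `|(a *m W w) i 0|] = \big[setU/set0]_i F i.
  rewrite -bigcup_seq; apply/seteqP; split=> w /=.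
    by move=> [i Hi]; exists i => //=; rewrite mem_index_enum.
  by move=> [i _ Hi]; exists i.
pose c := 2 * expR (- t ^+ 2 / (2 * s ^+ 2 * v)).
have -> : ((m%:R * c)%:E = \sum_(i < m) c%:E)%E.
  by rewrite sumEFin sumr_const card_ord mulr_natl.
(* Measurability is carried along because subadditivity asks it of both sets. *)
apply: (big_ind2 (fun A x => measurable A /\ (P A <= x)%E)).
- by rewrite measure0.
- move=> A x B y [mA Ax] [mB By]; split; first exact: measurableU.
  by apply: le_trans (measureU2 _ mA mB) _; exact: leeD.
move=> i _; split; first exact: measurable_noise_ge.
have rowE w : (a *m W w) i 0 = (row i a *m W w) 0 0.
  by rewrite -row_mul [RHS]mxE.
rewrite /F; under eq_set do rewrite rowE.
by apply: gaussian_noise_tail => //; under eq_bigr do rewrite mxE.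
Qed.

End gaussian_tail.

(** * Coordinate embeddings as matrices *)

Section embedding.
Context {R : realType} {p : nat}.
Implicit Types T : {set 'I_p}.

(** Inclusion of the coordinates in [T]. Restrictions, paddings and submatrices become products with
    it, so later identities are plain matrix algebra. *)
Definition embmx T : 'M[R]_(p, #|T|) := \matrix_(i, k) (enum_val k == i)%:R.

Lemma mulmx_embmx m T (A : 'M[R]_(m, p)) i k : (A *m embmx T) i k = A i (enum_val k).
Proof.
rewrite mxE (bigD1 (enum_val k))//= big1 ?mxE ?eqxx ?mulr1 ?addr0// => j jk.
by rewrite mxE eq_sym (negPf jk) mulr0.
Qed.

Lemma tr_embmx_mul m T (A : 'M[R]_(p, m)) k j : ((embmx T)^T *m A) k j = A (enum_val k) j.
Proof. by rewrite -[A in LHS]trmxK -trmx_mul mxE mulmx_embmx mxE. Qed.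

Lemma embmx_mul_in m T (A : 'M[R]_(#|T|, m)) k j : (embmx T *m A) (enum_val k) j = A k j.
Proof.
rewrite mxE (bigD1 k)//= big1 ?mxE ?eqxx ?mul1r ?addr0// => l lk.
by rewrite mxE (inj_eq enum_val_inj) (negPf lk) mul0r.
Qed.

Lemma embmx_mul_out m T (A : 'M[R]_(#|T|, m)) i j : i \notin T -> (embmx T *m A) i j = 0.
Proof.
move=> iT; rewrite mxE big1// => l _; rewrite mxE.
by case: eqP => [li|]; rewrite ?mul0r//; rewrite -li enum_valP in iT.
Qed.

Lemma embmx_supported T (u : 'cV[R]_p) : supp u \subset T ->
  embmx T *m ((embmx T)^T *m u) = u.
Proof.
move=> /fintype.subsetP uT; apply/colP => i.
have [iT|iT] := boolP (i \in T).
  by rewrite -(enum_rankK_in iT iT) embmx_mul_in tr_embmx_mul.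
rewrite embmx_mul_out//; apply/esym/eqP; apply: contraNT iT => ui.
by apply: uT; rewrite inE.
Qed.

Lemma extvE T u : extv T u = embmx T *m u :> 'cV[R]_p.
Proof.
apply/colP => i; rewrite !mxE; apply: eq_bigr => k _; rewrite mxE.
by case: eqP; rewrite ?mul1r ?mul0r.
Qed.

Lemma subvE T (u : 'cV[R]_p) : subv T u = (embmx T)^T *m u.
Proof. by apply/colP => k; rewrite tr_embmx_mul mxE. Qed.

Lemma submE T1 T2 (A : 'M[R]_p) : subm T1 T2 A = (embmx T1)^T *m A *m embmx T2.
Proof. by apply/matrixP => i j; rewrite mulmx_embmx tr_embmx_mul mxE. Qed.

Lemma colsTE n T (X : 'M[R]_(n, p)) : colsT T X = X *m embmx T.
Proof. by apply/matrixP => i j; rewrite mulmx_embmx mxE. Qed.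

End embedding.

(** * Euclidean norm and minimum singular value *)

Section norms.
Context {R : realType}.

Lemma dotmxE k (u v : 'cV[R]_k) : (u^T *m v) 0 0 = \sum_i u i 0 * v i 0.
Proof. by rewrite mxE; apply: eq_bigr => i _; rewrite mxE. Qed.

Lemma norm2_sqr k (u : 'cV[R]_k) : norm2 u ^+ 2 = (u^T *m u) 0 0.
Proof.
rewrite dotmxE /norm2 sqr_sqrtr; last by apply: sumr_ge0 => i _; exact: sqr_ge0.
by apply: eq_bigr => i _; rewrite expr2.
Qed.

Lemma norm2_ge0 k (u : 'cV[R]_k) : 0 <= norm2 u.
Proof. exact: sqrtr_ge0. Qed.

Lemma norm2Z k a (u : 'cV[R]_k) : norm2 (a *: u) = `|a| * norm2 u.
Proof.
rewrite /norm2 -sqrtr_sqr -sqrtrM ?sqr_ge0// mulr_sumr; congr Num.sqrt.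
by apply: eq_bigr => i _; rewrite mxE exprMn.
Qed.

Lemma ler_norm2 k (u : 'cV[R]_k) i : `|u i 0| <= norm2 u.
Proof.
rewrite /norm2 -sqrtr_sqr ler_sqrt; last by apply: sumr_ge0 => j _; exact: sqr_ge0.
by rewrite (bigD1 i)//= lerDl sumr_ge0// => j _; exact: sqr_ge0.
Qed.

Lemma norm2_eq0 k (u : 'cV[R]_k) : (norm2 u == 0) = (u == 0).
Proof.
apply/eqP/eqP => [u0|->]; last by rewrite -(scale0r 0) norm2Z normr0 mul0r.
apply/colP => i; rewrite mxE; apply/eqP; rewrite -normr_le0 -u0.
exact: ler_norm2.
Qed.

Lemma norm20 k : norm2 (0 : 'cV[R]_k) = 0.
Proof. by apply/eqP; rewrite norm2_eq0. Qed.

Lemma norm2_delta k (i : 'I_k) : norm2 (delta_mx i 0 : 'cV[R]_k) = 1.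
Proof.
rewrite /norm2 (bigD1 i)//= big1 ?mxE ?eqxx ?expr1n ?addr0 ?sqrtr1// => j ji.
by rewrite mxE (negPf ji) expr0n.
Qed.

Lemma sigma_min_le k (A : 'M[R]_k) (c : R) (u : 'cV[R]_k) :
  (c%:E <= sigma_min A)%E -> c * norm2 u <= norm2 (A *m u).
Proof.
move=> cA; have [->|u0] := eqVneq u 0.
  by rewrite mulmx0 !norm20 mulr0.
have nu : 0 < norm2 u by rewrite lt_neqAle eq_sym norm2_eq0 u0 norm2_ge0.
have : c <= norm2 (A *m ((norm2 u)^-1 *: u)).
  rewrite -lee_fin; apply: le_trans cA _; apply: ereal_inf_lbound => /=.
  exists ((norm2 u)^-1 *: u) => //.
  by rewrite norm2Z ger0_norm ?invr_ge0 ?norm2_ge0// mulVf// gt_eqF.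
by rewrite -scalemxAr norm2Z ger0_norm ?invr_ge0 ?norm2_ge0// mulrC ler_pdivlMr.
Qed.

Lemma unitmx_inj k (A : 'M[R]_k) : (forall u : 'cV[R]_k, A *m u = 0 -> u = 0) ->
  A \in unitmx.
Proof.
move=> A0; rewrite -unitmx_tr -row_free_unit -kermx_eq0; apply/rowV0P => v.
move=> /sub_kermxP vA; rewrite -[v]trmxK (A0 v^T) ?trmx0//.
by rewrite -[A]trmxK -trmx_mul vA trmx0.
Qed.

Lemma sigma_min_unitmx k (A : 'M[R]_k) (c : R) :
  0 < c -> (c%:E <= sigma_min A)%E -> A \in unitmx.
Proof.
move=> c0 cA; apply: unitmx_inj => u Au; apply/eqP; rewrite -norm2_eq0.
have := sigma_min_le u cA; rewrite Au norm20.
by rewrite pmulr_rle0// => nu; rewrite eq_le nu norm2_ge0.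
Qed.

(** The singular value bound is applied to column [i] of the inverse, which [A] maps to a unit
    vector; a diagonal entry is at most the norm of its column. *)
Lemma sigma_min_invmx_diag k (A : 'M[R]_k) (c : R) i :
  0 < c -> (c%:E <= sigma_min A)%E -> invmx A i i <= c^-1.
Proof.
move=> c0 cA; have uA := sigma_min_unitmx c0 cA.
have := sigma_min_le (invmx A *m delta_mx i 0) cA.
rewrite mulKVmx// norm2_delta mulrC -ler_pdivlMr// div1r => le1.
apply: le_trans le1; apply: le_trans (ler_norm2 _ i).
by rewrite -colE mxE ler_norm.
Qed.

End norms.

(** * Uniqueness of the Lasso minimizer under strict dual feasibility *)

Section lasso.
Context {R : realType} {n p : nat}.
Implicit Types (X : 'M[R]_(n, p)) (Y : 'cV[R]_n) (th : 'cV[R]_p).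

(* [X^T (X t - Y) / n] is the gradient at [t] of the quadratic part of the objective. *)
Lemma lasso_unique X Y (lam : R) th t (T : {set 'I_p}) :
  (0 < n)%N -> 0 < lam ->
  let g := n%:R^-1 *: (X^T *m (X *m t - Y)) in
  (forall i, i \in T -> g i 0 = - lam * Num.sg (t i 0)) ->
  (forall i, i \notin T -> t i 0 = 0 /\ `|g i 0| < lam) ->
  (forall h : 'cV[R]_p, (forall i, i \notin T -> h i 0 = 0) -> X *m h = 0 -> h = 0) ->
  is_lasso X Y lam th -> th = t.
Proof.
move=> n0 lam0 g gT gNT inj /(_ t); rewrite -subr_ge0.
have nR : (n%:R : R) != 0 by rewrite pnatr_eq0 -lt0n.
pose h := th - t.
have thE : th = t + h by rewrite /h addrC subrK.
pose e i := g i 0 * h i 0 + lam * (`|th i 0| - `|t i 0|).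
(* Exact second-order expansion at [t]: [e i] collects the linear and penalty terms of coordinate
   [i]. *)
have -> : lasso_obj X Y lam t - lasso_obj X Y lam th =
    - ((2 * n%:R)^-1 * norm2 (X *m h) ^+ 2 + \sum_i e i).
  have -> : \sum_i e i = (g^T *m h) 0 0 + lam * (norm1 th - norm1 t).
    by rewrite big_split/= dotmxE -mulr_sumr sumrB.
  have Xth : Y - X *m th = (Y - X *m t) - X *m h by rewrite thE mulmxDr opprD addrA.
  have -> : g^T *m h = - (n%:R^-1 *: ((Y - X *m t)^T *m (X *m h))).
    rewrite /g linearZ/= trmx_mul trmxK -opprB linearN/= mulNmx scalerN mulNmx.
    by rewrite -scalemxAl mulmxA.
  rewrite /lasso_obj Xth; move: (Y - X *m t) (X *m h) => r z.
  rewrite !norm2_sqr [(r - z)^T]linearB/= mulmxBl !mulmxBr.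
  have -> : (z^T *m r) = (r^T *m z).
    by apply/matrixP => i j; rewrite !ord1 !dotmxE; apply: eq_bigr => k _; rewrite mulrC.
  have mB (A B : 'M[R]_1) : (A - B) 0 0 = A 0 0 - B 0 0 by rewrite !mxE.
  have mN (A : 'M[R]_1) : (- A) 0 0 = - A 0 0 by rewrite mxE.
  have mZ a (A : 'M[R]_1) : (a *: A) 0 0 = a * A 0 0 by rewrite mxE.
  by rewrite !mB mN mZ; field.
rewrite oppr_ge0 => le0.
(* On [T] this is the subgradient inequality for the absolute value at [t i 0]; off [T] the penalty
   dominates the gradient. *)
have e0 i : 0 <= e i.
  have [iT|iT] := boolP (i \in T).
    rewrite /e gT//; set s := Num.sg _.
    have -> : - lam * s * h i 0 + lam * (`|th i 0| - `|t i 0|) =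
      lam * (`|th i 0| - (`|t i 0| + s * h i 0)) by ring.
    rewrite mulr_ge0 ?(ltW lam0)// subr_ge0 {}/s.
    have -> : `|t i 0| = Num.sg (t i 0) * t i 0 by exact: normrEsg.
    rewrite -mulrDr thE !mxE; apply: le_trans (ler_norm _) _; rewrite normrM.
    by rewrite ler_piMl// normr_sg lern1 leq_b1.
  have [ti gi] := gNT _ iT.
  rewrite /e thE [(t + h) i 0]mxE ti add0r normr0 subr0.
  have := ler_norm (- (g i 0 * h i 0)); rewrite normrN normrM => le1.
  have := ler_wpM2r (normr_ge0 (h i 0)) (ltW gi); lra.
have ps : \sum_i e i = 0 /\ norm2 (X *m h) ^+ 2 = 0.
  have s0 : 0 <= \sum_i e i by apply: sumr_ge0.
  have q0 : 0 <= (2 * n%:R)^-1 * norm2 (X *m h) ^+ 2.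
    by rewrite mulr_ge0 ?sqr_ge0// invr_ge0 mulr_ge0.
  have q1 : (2 * n%:R)^-1 * norm2 (X *m h) ^+ 2 = 0 by lra.
  split; first by lra.
  by move/eqP: q1; rewrite mulf_eq0 invr_eq0 mulf_eq0 pnatr_eq0/= (negPf nR) => /eqP.
case: ps => es; move/eqP; rewrite expf_eq0/= norm2_eq0 => /eqP Xh.
suff : h = 0 by rewrite thE => ->; rewrite addr0.
(* Off [T] the strict inequality makes [e i] positive unless [h i 0] vanishes. *)
apply: inj => // i iT; have [ti gi] := gNT _ iT.
have : e i = 0.
  by move/eqP: es; rewrite psumr_eq0// => /allP/(_ i); rewrite mem_index_enum => /(_ isT)/eqP.
rewrite /e thE [(t + h) i 0]mxE ti add0r normr0 subr0 => ei.
apply/eqP; rewrite -normr_le0 leNgt; apply/negP => hi.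
have := ler_norm (- (g i 0 * h i 0)); rewrite normrN normrM => le1.
by have : `|g i 0| * `|h i 0| < lam * `|h i 0|; [rewrite ltr_pM2r|lra].
Qed.

End lasso.

(** * Stationarity in the zero-noise problem *)

Section zero_noise.
Context {R : realType} {p : nat}.

Lemma sgr_norm_add (x e : R) : `|e| <= `|x| -> x != 0 ->
  `|x + e| - `|x| = e * Num.sg x.
Proof.
move=> ex x0; have [xgt|xlt|xe] := ltgtP x 0; last by rewrite xe eqxx in x0.
- move: ex; rewrite (ltr0_norm xgt) ler_norml opprK => /andP[_ ex].
  by rewrite ltr0_sg// ler0_norm; lra.
- move: ex; rewrite (gtr0_norm xlt) ler_norml => /andP[ex _].
  by rewrite gtr0_sg// ger0_norm; lra.
Qed.

Lemma lin_quad_ge0_eq0 (q a del : R) : 0 < del ->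
  (forall e, `|e| <= del -> 0 <= e * q + e ^+ 2 * a) -> q = 0.
Proof.
move=> del0 H; apply/eqP; apply/negPn/negP => q0.
have nq : 0 < `|q| by rewrite normr_gt0.
have a1 : 0 < `|a| + 1 by rewrite ltr_wpDl.
(* The first bound keeps the step [- (k * q)] within [del]; the second gives [k * a <= 1 / 2], so
   the linear term wins and the value is negative. *)
pose k := Num.min (del / `|q|) ((`|a| + 1)^-1 / 2).
have k0 : 0 < k by rewrite lt_min !divr_gt0// invr_gt0.
have kq : k * `|q| <= del by rewrite -ler_pdivlMr// ge_min lexx.
have ka : k * (`|a| + 1) <= 2^-1.
  by rewrite -ler_pdivlMr// mulrC ge_min lexx orbT.
have := H (- (k * q)); rewrite normrN normrM (gtr0_norm k0) => /(_ kq).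
have -> : - (k * q) * q + (- (k * q)) ^+ 2 * a = k * q ^+ 2 * (k * a - 1) by ring.
rewrite pmulr_rge0; last by rewrite mulr_gt0// exprn_even_gt0.
have := ler_wpM2l (ltW k0) (ler_norm a); lra.
Qed.

(** Moving coordinate [i] by at most its modulus does not cross zero, so the objective is exactly
    quadratic in the step and its linear coefficient must vanish. *)
Lemma zn_min_stationary (Sig : 'M[R]_p) theta0 xi th i :
  Sig^T = Sig -> is_zn_min Sig theta0 xi th -> th i 0 != 0 ->
  (Sig *m (th - theta0)) i 0 = - xi * Num.sg (th i 0).
Proof.
move=> SigT min_th thi0; apply/eqP; rewrite mulNr -addr_eq0; apply/eqP.
apply: (@lin_quad_ge0_eq0 _ (2^-1 * Sig i i) `|th i 0|); first by rewrite normr_gt0.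
move=> e le_e; have := min_th (th + e *: delta_mx i 0); rewrite -subr_ge0 /zn_obj.
have -> : norm1 (th + e *: delta_mx i 0) = norm1 th + e * Num.sg (th i 0).
  rewrite -sgr_norm_add// /norm1 (bigD1 i)//= [in RHS](bigD1 i)//=.
  rewrite !mxE !eqxx mulr1; under eq_bigr => j ji do
    rewrite !mxE (negPf ji) mulr0 addr0.
  ring.
have -> : th + e *: delta_mx i 0 - theta0 = (th - theta0) + e *: delta_mx i 0.
  by rewrite addrAC.
move: (th - theta0) => v; set d := delta_mx i 0.
have symm (u u' : 'cV[R]_p) : u^T *m Sig *m u' = u'^T *m Sig *m u.
  have tr11 (A : 'M[R]_1) : A^T = A by apply/matrixP => j k; rewrite !ord1 mxE.
  by rewrite -[LHS]tr11 !trmx_mul trmxK SigT mulmxA.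
have -> : ((v + e *: d)^T *m Sig *m (v + e *: d)) 0 0 =
    (v^T *m Sig *m v) 0 0 + 2 * e * (Sig *m v) i 0 + e ^+ 2 * Sig i i.
  have dS (u : 'cV[R]_p) : (d^T *m Sig *m u) 0 0 = (Sig *m u) i 0.
    by rewrite -mulmxA trmx_delta -rowE mxE.
  have Sd : (Sig *m d) i 0 = Sig i i by rewrite -colE mxE.
  rewrite [(v + _)^T]linearD/= [(e *: d)^T]linearZ/= !(mulmxDl, mulmxDr).
  rewrite -!scalemxAl -!scalemxAr (symm v d).
  have mD (A B : 'M[R]_1) : (A + B) 0 0 = A 0 0 + B 0 0 by rewrite mxE.
  have mZ a (A : 'M[R]_1) : (a *: A) 0 0 = a * A 0 0 by rewrite mxE.
  rewrite !mD !mZ !dS Sd; ring.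
by congr (0 <= _); field.
Qed.

End zero_noise.

(** * Selection by ranking the moduli *)

Section selection.
Context {R : realType} {p : nat}.

Lemma Shat_threshold (u : 'cV[R]_p) (S : {set 'I_p}) (tau : R) :
  (forall i, i \in S -> tau < `|u i 0|) -> (forall i, i \notin S -> `|u i 0| < tau) ->
  Shat u #|S| = S.
Proof.
move=> uS uNS; have [S0|S0] := posnP #|S|.
  rewrite S0; apply/setP => i; rewrite !inE ltnn/=.
  by rewrite (cards0_eq S0) inE.
pose f i := `|u i 0|; pose ge := (fun x y : R => y <= x).
have geT : total ge by move=> x y; exact: le_total.
have ge_tr : transitive ge by move=> x y z yx xz; exact: le_trans xz yx.
have ge_anti : antisymmetric ge by move=> x y /andP[? ?]; apply/le_anti/andP.
pose A := sort ge (map f (enum S)); pose B := sort ge (map f (enum (~: S))).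
have sA : size A = #|S| by rewrite size_sort size_map -cardE.
have memA x : x \in A -> exists2 i, i \in S & x = f i.
  by rewrite mem_sort => /mapP[i]; rewrite mem_enum; exists i.
have memB x : x \in B -> exists2 i, i \notin S & x = f i.
  by rewrite mem_sort => /mapP[i]; rewrite mem_enum inE; exists i.
(* Every modulus on [S] exceeds every modulus off [S], so the concatenation is sorted; a sorted
   permutation is unique. *)
have sortE : sort ge (map f (enum 'I_p)) = A ++ B.
  apply: (sorted_eq ge_tr ge_anti).
  - exact: sort_sorted.
  - rewrite (sorted_pairwise ge_tr) pairwise_cat -!(sorted_pairwise ge_tr).
    rewrite !sort_sorted// !andbT; apply/allrelP => x y /memA[i iS ->] /memB[j jS ->].
    by apply: ltW; apply: lt_trans (uNS _ jS) (uS _ iS).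
  - rewrite perm_sort perm_sym.
    apply: (@perm_trans _ (map f (enum S ++ enum (~: S)))).
      by rewrite map_cat perm_cat// perm_sort.
    apply: perm_map; apply: uniq_perm.
    + rewrite cat_uniq !enum_uniq andbT/=; apply/hasPn => i.
      by rewrite /= !mem_enum inE.
    + exact: enum_uniq.
    + by move=> i; rewrite mem_cat !mem_enum !inE orbN.
(* Counting from 0, this index is the last one of [A]: the cutoff is the smallest modulus on [S]. *)
have kE : kth_largest u #|S| = nth 0 A #|S|.-1.
  by rewrite /kth_largest sortE nth_cat sA prednK// leqnn.
have kA : nth 0 A #|S|.-1 \in A by rewrite mem_nth// sA prednK.
apply/setP => i; rewrite inE S0/= kE; apply/idP/idP => [|iS].
  have [j jS ->] := memA _ kA; apply: contraTT => iS.
  by rewrite -ltNge; apply: lt_trans (uNS _ iS) (uS _ jS).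
have : f i \in A by rewrite mem_sort map_f// mem_enum.
move=> /(nthP 0)[k]; rewrite sA -[`|u i 0|]/(f i) => kS <-.
have /(sorted_leq_nth ge_tr) := sort_sorted geT (map f (enum S)).
move=> /(_ (fun=> lexx _) 0); apply; rewrite ?inE ?sA ?prednK//.
by rewrite -ltnS prednK.
Qed.

End selection.

(** * Least squares and residual maps of the design *)

Lemma row_sum_sqr {R : realType} m n (A : 'M[R]_(m, n)) i :
  \sum_j A i j ^+ 2 = (A *m A^T) i i.
Proof. by rewrite mxE; apply: eq_bigr => j _; rewrite [A^T _ _]mxE expr2. Qed.

Section design.
Context {R : realType} {n p : nat}.
Variables (X : 'M[R]_(n, p)) (T : {set 'I_p}) (Cmin : R).
Hypotheses (n0 : (0 < n)%N) (Cmin0 : 0 < Cmin).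
Hypothesis CminX : (Cmin%:E <= sigma_min (subm T T (Sigmahat X)))%E.

Let Sig := Sigmahat X.
Let E : 'M[R]_(p, #|T|) := embmx T.
Let M := subm T T Sig.
Let XT := colsT T X.
Let N := XT^T *m XT.

Let nR : (n%:R : R) != 0. Proof. by rewrite pnatr_eq0 -lt0n. Qed.

Let nR0 : (0 : R) < n%:R. Proof. by rewrite ltr0n. Qed.

Lemma Sigmahat_tr : Sig^T = Sig.
Proof. by rewrite /Sig /Sigmahat linearZ/= trmx_mul trmxK. Qed.

Let XTE : XT = X *m E. Proof. exact: colsTE. Qed.

Let ME : M = E^T *m Sig *m E. Proof. exact: submE. Qed.

Let NE : N = n%:R *: M.
Proof.
rewrite ME /N XTE /Sig /Sigmahat -scalemxAr -scalemxAl scalerA mulfV// scale1r.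
by rewrite trmx_mul !mulmxA.
Qed.

Let uM : M \in unitmx. Proof. exact: sigma_min_unitmx Cmin0 CminX. Qed.

Let uN : N \in unitmx. Proof. by rewrite NE unitmxZ ?unitfE. Qed.

Let NT : N^T = N. Proof. by rewrite /N trmx_mul trmxK. Qed.

(* Least squares on the columns in [T], padded with zeros. *)
Definition lsq_mx : 'M[R]_(p, n) := E *m (invmx N *m XT^T).

(* [resid_mx *m W] is [X^T (1 - P) W / n], [P] the projection onto the columns in [T]. *)
Definition resid_mx : 'M[R]_(p, n) := n%:R^-1 *: (X^T - X^T *m X *m lsq_mx).

Lemma lsq_mx_supported (u : 'cV[R]_p) : supp u \subset T -> lsq_mx *m (X *m u) = u.
Proof.
move=> uT; rewrite -{1}(embmx_supported uT) -/E /lsq_mx -!mulmxA (mulmxA X) -XTE.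
by rewrite (mulmxA XT^T) -/N mulKmx//; exact: embmx_supported.
Qed.

Lemma gauss_lasso_lsq_mx Y thL : supp thL = T -> gauss_lasso X Y thL = lsq_mx *m Y.
Proof. by move=> thT; rewrite /gauss_lasso thT extvE /lsq_mx !mulmxA. Qed.

(** The normal equations: the residual is orthogonal to the columns in [T]. *)
Let tr_E_resid : E^T *m resid_mx = 0.
Proof.
rewrite /resid_mx -scalemxAr mulmxBr /lsq_mx.
have -> : E^T *m (X^T *m X *m (E *m (invmx N *m XT^T))) = N *m (invmx N *m XT^T).
  by rewrite /N XTE trmx_mul !mulmxA.
by rewrite mulKVmx// XTE trmx_mul subrr scaler0.
Qed.

(** The Gram matrix of the rows is [invmx N] padded with zeros, and [N] is [n%:R *: M], so the bound
    on the diagonal of [invmx M] applies. *)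
Lemma lsq_mx_row_sum i : \sum_j lsq_mx i j ^+ 2 <= (n%:R * Cmin)^-1.
Proof.
rewrite row_sum_sqr.
have -> : lsq_mx *m lsq_mx^T = E *m (invmx N *m E^T).
  rewrite {2}/lsq_mx !trmx_mul trmxK trmx_inv NT /lsq_mx -!mulmxA.
  by rewrite (mulmxA XT^T) -/N mulKmx.
have [iT|iT] := boolP (i \in T); last first.
  by rewrite embmx_mul_out// invr_ge0 mulr_ge0// ltW.
rewrite -(enum_rankK_in iT iT) embmx_mul_in -[invmx N *m _]trmxK mxE trmx_mul trmxK.
rewrite embmx_mul_in mxE NE invmxZ -?NE// mxE invfM ler_pM2l ?invr_gt0//.
exact: sigma_min_invmx_diag.
Qed.

(** [P] is symmetric and idempotent, hence projecting it out only lowers the diagonal of [Sig]. *)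
Lemma resid_mx_row_sum i : Sig i i <= 1 -> \sum_j resid_mx i j ^+ 2 <= n%:R^-1.
Proof.
move=> Sig1; rewrite row_sum_sqr.
pose P := X *m lsq_mx.
have PT : P^T = P.
  by rewrite /P /lsq_mx (mulmxA X) -XTE !trmx_mul trmxK trmx_inv NT !mulmxA.
have PP : P *m P = P.
  rewrite /P /lsq_mx (mulmxA X E) -XTE !mulmxA -(mulmxA _ XT^T XT) -/N.
  by rewrite -(mulmxA XT) mulVmx// mulmx1.
have rE : resid_mx = n%:R^-1 *: (X^T *m (1%:M - P)).
  by rewrite /resid_mx mulmxBr mulmx1 /P (mulmxA X^T X lsq_mx).
clearbody P.
have -> : resid_mx *m resid_mx^T = n%:R^-1 *: (Sig - n%:R^-1 *: ((P *m X)^T *m (P *m X))).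
  rewrite rE linearZ/= trmx_mul trmxK [(1%:M - P)^T]linearB/= trmx1 PT -scalemxAl -scalemxAr.
  rewrite /Sig /Sigmahat -scalerBr; congr (_ *: (_ *: _)).
  rewrite trmx_mul PT !mulmxA -(mulmxA X^T P P) PP -(mulmxA X^T (1%:M - P)).
  have -> : (1%:M - P) *m (1%:M - P) = 1%:M - P.
    by rewrite mulmxBr mulmx1 mulmxBl mul1mx PP subrr subr0.
  by rewrite mulmxBr mulmx1 mulmxBl.
rewrite mxE -[leRHS]mulr1 ler_pM2l ?invr_gt0//; apply: le_trans Sig1.
rewrite mxE gerDl !mxE oppr_le0 mulr_ge0 ?invr_ge0//.
by apply: sumr_ge0 => j _; rewrite mxE -expr2 sqr_ge0.
Qed.

(** * The dual vector, the zero-noise path and exact Lasso support *)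

Section dual.
Variable v0 : 'cV[R]_p.
Let w := extv T (invmx M *m subv T v0).

Let wE : w = E *m (invmx M *m (E^T *m v0)).
Proof. by rewrite /w extvE subvE. Qed.

Lemma Sigmahat_dual_in i : i \in T -> (Sig *m w) i 0 = v0 i 0.
Proof.
move=> iT; rewrite -(enum_rankK_in iT iT) -!tr_embmx_mul wE -/E !mulmxA -ME.
by rewrite mulmxV// mul1mx.
Qed.

Lemma Sigmahat_dual_out i : i \notin T ->
  `|(Sig *m w) i 0| <= norminf (subm (~: T) T Sig *m invmx M *m subv T v0).
Proof.
move=> iT; have iC : i \in ~: T by rewrite inE.
have -> : (Sig *m w) i 0 =
    (subm (~: T) T Sig *m invmx M *m subv T v0) (enum_rank_in iC i) 0.
  by rewrite submE subvE -!mulmxA tr_embmx_mul enum_rankK_in// wE.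
exact: (le_bigmax _ (fun k => `|(_ *m _) k 0|)).
Qed.

(** Both [th] and [theta0] live on [T], where stationarity is a linear system with the invertible
    matrix [M]. *)
Lemma zn_minE theta0 xi th : is_zn_min Sig theta0 xi th -> sgnv th = v0 ->
  supp v0 = T -> supp theta0 \subset T -> th = theta0 - xi *: w.
Proof.
move=> min_th sg_th v0T th0T.
have thT i : (th i 0 != 0) = (i \in T).
  by rewrite -v0T inE -sg_th mxE sgr_eq0.
have stat i : i \in T -> (Sig *m (th - theta0)) i 0 = - xi * v0 i 0.
  move=> iT; rewrite (zn_min_stationary Sigmahat_tr min_th) ?thT//.
  by rewrite -sg_th mxE.
have dT : supp (th - theta0) \subset T.
  apply/fintype.subsetP => i; rewrite inE mxE; apply: contraNT => iT.
  have -> : th i 0 = 0 by apply/eqP; rewrite -[_ == _]negbK thT.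
  rewrite mxE sub0r oppr_eq0; apply: contraNT iT => t0.
  by move/fintype.subsetP: th0T; apply; rewrite inE.
have Mz : M *m (E^T *m (th - theta0)) = - xi *: (E^T *m v0).
  apply/colP => k; rewrite ME -!mulmxA embmx_supported// tr_embmx_mul stat ?enum_valP//.
  by rewrite mxE tr_embmx_mul.
suff : th - theta0 = - (xi *: w) by move/eqP; rewrite subr_eq addrC => /eqP.
rewrite -(embmx_supported dT) -/E -(mulKmx uM (E^T *m _)) Mz wE -!scalemxAr.
by rewrite scaleNr.
Qed.

Lemma lasso_exact theta0 W (lam : R) th : 0 < lam ->
  supp v0 = T -> supp theta0 \subset T ->
  (forall i, i \in T -> Num.sg ((theta0 - lam *: w + lsq_mx *m W) i 0) = v0 i 0) ->
  (forall i, i \notin T -> `|(Sig *m w) i 0| * lam + `|(resid_mx *m W) i 0| < lam) ->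
  is_lasso X (X *m theta0 + W) lam th -> supp th = T.
Proof.
move=> lam0 v0T th0T sgT resT min_th.
pose t := theta0 - lam *: w + lsq_mx *m W.
(* Gradient at [t]. On [T] the residual part vanishes and [Sig *m w] is [v0]; off [T] the two parts
   together stay below [lam]. *)
have gE : n%:R^-1 *: (X^T *m (X *m t - (X *m theta0 + W))) =
    - (lam *: (Sig *m w)) - resid_mx *m W.
  have -> : X *m t - (X *m theta0 + W) = - (lam *: (X *m w)) - (W - X *m (lsq_mx *m W)).
    rewrite /t mulmxDr mulmxBr -scalemxAr.
    move: (X *m theta0) (X *m w) (X *m (lsq_mx *m W)) => a b c.
    by apply/colP => i; rewrite !mxE; ring.
  rewrite /resid_mx /Sig /Sigmahat -!scalemxAl mulmxBr mulmxN -scalemxAr scalerBr scalerN.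
  rewrite !scalerA (mulrC lam) mulmxBl mulmxBr.
  by rewrite (mulmxA X^T X w) -(mulmxA (X^T *m X)) (mulmxA X^T X (lsq_mx *m W)).
have tout i : i \notin T -> t i 0 = 0.
  move=> iT; have th0i : theta0 i 0 = 0.
    apply/eqP; apply: contraNT iT => th0i.
    by move/fintype.subsetP: th0T; apply; rewrite inE.
  have -> : t = theta0 - lam *: w + E *m (invmx N *m XT^T *m W) by rewrite mulmxA.
  rewrite mxE embmx_mul_out// addr0 mxE th0i add0r wE mxE mxE embmx_mul_out//.
  by rewrite mulr0 oppr0.
have tT : supp t = T.
  apply/setP => i; rewrite inE -sgr_eq0; have [iT|iT] := boolP (i \in T).
    by rewrite sgT//; move: iT; rewrite -v0T inE.
  by rewrite tout// sgr0 eqxx.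
suff -> : th = t by [].
have mB (a b : 'cV[R]_p) i : (- (lam *: a) - b) i 0 = - (lam * a i 0) - b i 0.
  by rewrite !mxE.
apply: (@lasso_unique _ _ _ X (X *m theta0 + W) lam th t T) => //.
- move=> i iT; rewrite gE sgT// mB Sigmahat_dual_in//.
  rewrite -(enum_rankK_in iT iT) -[(resid_mx *m W) _ _]tr_embmx_mul mulmxA tr_E_resid.
  by rewrite mul0mx mxE subr0 mulNr.
- move=> i iT; split; first exact: tout.
  rewrite gE mB; apply: le_lt_trans (resT _ iT); apply: le_trans (ler_normB _ _) _.
  by rewrite normrN normrM (gtr0_norm lam0) mulrC.
(* [lsq_mx] is a left inverse of [X] on vectors supported in [T], whence injectivity. *)
- move=> h hT Xh; rewrite -(lsq_mx_supported (u := h)) ?Xh ?mulmx0//.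
  apply/fintype.subsetP => i; rewrite inE; apply: contraNT => iT.
  by rewrite hT.
Qed.

End dual.
End design.

(** * Support recovery for a fixed noise vector *)

Section recovery.
Context {R : realType}.

Lemma sgr_add_small (x e : R) : `|e| < `|x| -> Num.sg (x + e) = Num.sg x.
Proof.
rewrite ltr_norml => /andP[]; have [x0|x0|->] := ltgtP x 0.
- by rewrite (ltr0_norm x0) => e1 e2; rewrite (ltr0_sg x0) ltr0_sg//; lra.
- by rewrite (gtr0_norm x0) => e1 e2; rewrite (gtr0_sg x0) gtr0_sg//; lra.
- by rewrite normr0 => e1 e2; lra.
Qed.

Lemma lasso_support n p (X : 'M[R]_(n, p)) (theta0 v0 zn th : 'cV[R]_p) (W : 'cV[R]_n)
    (Cmin eta c2 lam xi : R) (T : {set 'I_p}) :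
  let Sig := Sigmahat X in
  let w := extv T (invmx (subm T T Sig) *m subv T v0) in
  (0 < n)%N -> 0 < Cmin -> (Cmin%:E <= sigma_min (subm T T Sig))%E ->
  0 < xi -> is_zn_min Sig theta0 xi zn -> sgnv zn = v0 ->
  supp v0 = T -> supp theta0 \subset T ->
  (forall i, i \in supp theta0 -> v0 i 0 = Num.sg (theta0 i 0)) ->
  norminf (subm (~: T) T Sig *m invmx (subm T T Sig) *m subv T v0) <= 1 - eta ->
  0 < lam ->
  (forall i, i \in supp theta0 -> c2 * lam + lam * `|w i 0| <= `|theta0 i 0|) ->
  (forall i, i \in T :\: supp theta0 -> c2 <= `|w i 0|) ->
  (forall i, `|(lsq_mx X T *m W) i 0| < c2 * lam) ->
  (forall i, `|(resid_mx X T *m W) i 0| < eta * lam) ->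
  is_lasso X (X *m theta0 + W) lam th -> supp th = T.
Proof.
move=> Sig w n0 Cmin0 CminX xi0 zn_min zn_sg v0T th0T v0S irrep lam0 thS wT lsqW residW.
have znE := zn_minE Cmin0 CminX zn_min zn_sg v0T th0T.
apply: (lasso_exact n0 Cmin0 CminX lam0 v0T th0T) => i iT.
  have lw : (- (lam *: w)) i 0 = - (lam * w i 0).
    by rewrite mxE; congr (- _); rewrite mxE.
  rewrite mxE; have [iS|iS] := boolP (i \in supp theta0).
    rewrite v0S// mxE -addrA sgr_add_small//; apply: lt_le_trans (thS i iS).
    apply: le_lt_trans (ler_normD _ _) _; rewrite lw normrN normrM (gtr0_norm lam0).
    by rewrite addrC ltrD2r.
  have th0i : theta0 i 0 = 0 by apply/eqP; move: iS; rewrite inE negbK.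
  have wi : c2 <= `|w i 0| by apply: wT; rewrite inE iS.
  rewrite mxE th0i add0r sgr_add_small; last first.
    rewrite lw normrN normrM (gtr0_norm lam0); apply: lt_le_trans (lsqW i) _.
    by rewrite mulrC ler_pM2l.
  (* Off the true support the zero-noise minimizer is [- xi * w i 0], which ties the sign [v0] to
     that of [w]. *)
  have -> : v0 i 0 = Num.sg ((theta0 - xi *: w) i 0) by rewrite -zn_sg znE mxE.
  have -> : (theta0 - xi *: w) i 0 = - (xi * w i 0).
    by rewrite mxE th0i add0r mxE; congr (- _); rewrite mxE.
  by rewrite lw !sgrN !sgrM (gtr0_sg lam0) (gtr0_sg xi0).
(* The dual part is at most [(1 - eta) * lam], leaving [eta * lam] for the residual noise. *)
have := le_trans (Sigmahat_dual_out X v0 iT) irrep.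
rewrite -/Sig -/w => H.
have := ler_wpM2r (ltW lam0) H; have := residW i; lra.
Qed.

End recovery.

(** Positivity of [mu] excludes the default value 0 of the maximum. *)
Lemma norminf_ge {R : realType} p (u : 'cV[R]_p) (mu : R) :
  0 < mu -> mu <= norminf u -> exists i, mu <= `|u i 0|.
Proof.
move=> mu0 le_mu; apply/not_existsP => lt_mu.
move: le_mu; rewrite leNgt => /negP; apply; apply/bigmax_ltP; split=> // i _.
by rewrite ltNge; apply/negP/lt_mu.
Qed.

(** * Bad noise events and the two probability bounds *)

Theorem theorem2p6 (R : realType) (n p : nat) (d : measure_display)
  (Omega : measurableType d) (P : probability Omega R)
  (X : 'M[R]_(n, p)) (theta0 : 'cV[R]_p) (sigma : R) (W : Omega -> 'cV[R]_n)
  (xi0 : R) (T0 : {set 'I_p}) (v0 : 'cV[R]_p) (thZN : R -> 'cV[R]_p)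
  (Cmin eta c1 c2 : R) (thL : Omega -> 'cV[R]_p) :
  (0 < n)%N -> (0 < p)%N -> 0 < sigma ->
  gaussian_noise P W sigma ->
  (forall i, Sigmahat X i i <= 1) ->
  (* zero-noise problem: T0, v0 as in the context *)
  0 < xi0 ->
  (forall xi, 0 < xi < xi0 ->
     is_zn_min (Sigmahat X) theta0 xi (thZN xi) /\ sgnv (thZN xi) = v0) ->
  supp v0 = T0 ->
  supp theta0 \subset T0 ->
  (forall i, i \in supp theta0 -> v0 i 0 = Num.sg (theta0 i 0)) ->
  (* (i) *)
  0 < Cmin -> (Cmin%:E <= sigma_min (subm T0 T0 (Sigmahat X)))%E ->
  (* (ii) *)
  0 < eta ->
  norminf (subm (~: T0) T0 (Sigmahat X) *m invmx (subm T0 T0 (Sigmahat X))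
             *m subv T0 v0) <= 1 - eta ->
  1 < c1 -> 0 < c2 ->
  let lam := sigma / eta * Num.sqrt (2 * c1 * ln (p%:R) / n%:R) in
  let w := extv T0 (invmx (subm T0 T0 (Sigmahat X)) *m subv T0 v0) in
  (* (iii) *)
  (forall i, i \in supp theta0 -> c2 * lam + lam * `|w i 0| <= `|theta0 i 0|) ->
  (forall i, i \in T0 :\: supp theta0 -> c2 <= `|w i 0|) ->
  eta <= c2 * Num.sqrt Cmin ->
  (* Lasso estimator (any choice of minimizer) with Y = X theta0 + W *)
  (forall om, is_lasso X (X *m theta0 + W om) lam (thL om)) ->
  let thGL := fun om => gauss_lasso X (X *m theta0 + W om) (thL om) in
  let s0 := #|supp theta0| in
  (forall mu, 0 < mu ->
    exists E : set Omega, measurable E /\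
      [set om | mu <= norminf (thGL om - theta0)] `<=` E /\
      (P E <= (4 * p%:R `^ (1 - c1)
               + 2 * p%:R * expR (- (n%:R * Cmin * mu ^+ 2) / (2 * sigma ^+ 2)))%:E)%E)
  /\
  (exists E : set Omega, measurable E /\
      E `<=` [set om | Shat (thGL om) s0 = supp theta0] /\
      ((1 - 6 * p%:R `^ (1 - c1 / 4))%:E <= P E)%E).
Proof.
move=> n0 p0 s0 noiseW Sig1 xi00 zn v0T th0T v0S Cmin0 CminX eta0 irrep c11 c20.
move=> lam w thS wT etaC lasso thGL s.
have pR : (1 : R) <= p%:R by rewrite ler1n.
(* Here all powers of [p] equal 1: the whole space and the empty set serve as events. *)
have [p1|p2] := leqP p 1.
  have -> : (p%:R : R) = 1 by rewrite (_ : p = 1%N)//; apply/eqP; rewrite eqn_leq p1.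
  rewrite !powR1 !mulr1; split=> [mu mu0|].
    exists setT; split=> //; split=> //; rewrite probability_setT lee_fin.
    by have := expR_ge0 (- (n%:R * Cmin * mu ^+ 2) / (2 * sigma ^+ 2)); lra.
  by exists set0; split=> //; split=> //; rewrite measure0 lee_fin; lra.
have lnp : 0 < ln (p%:R : R) by rewrite ln_gt0// ltr1n.
have nR0 : (0 : R) < n%:R by rewrite ltr0n.
have lam0 : 0 < lam.
  rewrite mulr_gt0 ?divr_gt0// sqrtr_gt0 !(mulr_gt0, invr_gt0)//.
  exact: lt_trans c11.
have etalam : (eta * lam) ^+ 2 * n%:R = 2 * c1 * sigma ^+ 2 * ln p%:R.
  have -> : eta * lam = sigma * Num.sqrt (2 * c1 * ln p%:R / n%:R).
    by rewrite /lam; field; rewrite gt_eqF.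
  rewrite exprMn sqr_sqrtr; last first.
    by apply/ltW; rewrite !(mulr_gt0, invr_gt0)//; exact: lt_trans c11.
  by field; rewrite gt_eqF.
clearbody lam.
(* From [eta <= c2 * Num.sqrt Cmin]: relative to its variance, the fit at level [c2 * lam] has a
   tail no larger than the residual at level [eta * lam]. *)
have c2lam : (eta * lam) ^+ 2 <= (c2 * lam) ^+ 2 * Cmin.
  have -> : (c2 * lam) ^+ 2 * Cmin = c2 ^+ 2 * Cmin * lam ^+ 2 by ring.
  rewrite exprMn ler_pM2r ?exprn_gt0//.
  by rewrite -(sqr_sqrtr (ltW Cmin0)) -exprMn ler_sqr// nnegrE ltW// mulr_gt0// sqrtr_gt0.
pose K := lsq_mx X T0; pose H := resid_mx X T0.
have rowK i := lsq_mx_row_sum n0 Cmin0 CminX i.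
have rowH i := resid_mx_row_sum n0 Cmin0 CminX (Sig1 i).
have nC : 0 < (n%:R * Cmin)^-1 by rewrite invr_gt0 mulr_gt0.
have nV : 0 < (n%:R : R)^-1 by rewrite invr_gt0.
(* Absorbs the factor [p] of the union bound. *)
have ppow (a : R) : (p%:R : R) * expR (- a * ln p%:R) = p%:R `^ (1 - a).
  rewrite powRD ?pnatr_eq0 -?lt0n ?p0 ?implybT// powRr1 ?ler0n//.
  by rewrite [in RHS]/powR gt_eqF ?ltr0n.
have s20 : 0 < 2 * sigma ^+ 2 by rewrite mulr_gt0// exprn_gt0.
have supported om : (forall i, `|(K *m W om) i 0| < c2 * lam) ->
    (forall i, `|(H *m W om) i 0| < eta * lam) ->
    thGL om = theta0 + K *m W om.
  move=> lsqW residW; have xi1 : 0 < xi0 / 2 < xi0 by lra.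
  have [zn_min zn_sg] := zn _ xi1; case/andP: xi1 => xi1 _.
  have thT := lasso_support n0 Cmin0 CminX xi1 zn_min zn_sg v0T th0T v0S irrep lam0
    thS wT lsqW residW (lasso om).
  rewrite /thGL (gauss_lasso_lsq_mx _ _ thT) mulmxDr.
  by rewrite (lsq_mx_supported n0 Cmin0 CminX).
have elam0 : 0 < eta * lam by rewrite mulr_gt0.
have clam0 : 0 < c2 * lam by rewrite mulr_gt0.
pose bad (A : 'M[R]_(p, n)) (t : R) := [set om | exists i, t <= `|(A *m W om) i 0|].
have notbad (A : 'M[R]_(p, n)) (t : R) om : ~ bad A t om -> forall i, `|(A *m W om) i 0| < t.
  by move=> nb i; rewrite ltNge; apply/negP => le_t; apply: nb; exists i.
have [mH PH] := gaussian_noise_union s0 noiseW nV elam0 rowH.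
rewrite -[X in measurable X]/(bad H (eta * lam)) in mH.
have {}PH : (P (bad H (eta * lam)%R) <= (2 * p%:R `^ (1 - c1))%:E)%E.
  apply: le_trans PH _; rewrite lee_fin -ppow mulrCA le_eqVlt; apply/orP; left; apply/eqP.
  congr (2 * (_ * expR _)).
  have -> : (eta * lam) ^+ 2 = 2 * c1 * sigma ^+ 2 * ln p%:R / n%:R.
    by rewrite -etalam mulfK// gt_eqF.
  by field; rewrite !gt_eqF.
(* Used with [a = 1] for the error bound and [a = 1/2] for selection; the square of the latter
   produces the exponent [c1 / 4]. *)
have tailK a : 0 < a -> measurable (bad K (a * (c2 * lam))) /\
    (P (bad K (a * (c2 * lam))%R) <= (2 * p%:R `^ (1 - c1 * a ^+ 2))%:E)%E.
  move=> a0; have ac0 : 0 < a * (c2 * lam) by rewrite mulr_gt0.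
  have [mK PK] := gaussian_noise_union s0 noiseW nC ac0 rowK; split=> //.
  apply: le_trans PK _; rewrite lee_fin -ppow mulrCA ler_pM2l// ler_pM2l ?ltr0n//.
  rewrite ler_expR exprMn.
  have -> : - (a ^+ 2 * (c2 * lam) ^+ 2) / (2 * sigma ^+ 2 * (n%:R * Cmin)^-1) =
      - (a ^+ 2 * ((c2 * lam) ^+ 2 * Cmin * n%:R / (2 * sigma ^+ 2))).
    by field; rewrite !gt_eqF.
  have -> : - (c1 * a ^+ 2) * ln p%:R = - (a ^+ 2 * (c1 * ln p%:R)) by ring.
  rewrite lerN2 ler_pM2l ?exprn_gt0// ler_pdivlMr//.
  have -> : c1 * ln p%:R * (2 * sigma ^+ 2) = (eta * lam) ^+ 2 * n%:R by rewrite etalam; ring.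
  by rewrite ler_pM2r.
have pow_ge0 a : 0 <= (p%:R : R) `^ a by exact: powR_ge0.
split=> [mu mu0|].
  have [mK PK] := tailK _ ltr01; rewrite !mul1r in mK PK.
  have [mM PM] := gaussian_noise_union s0 noiseW nC mu0 rowK.
  (* The first two events, outside which the support is exact, cost the factor 4; the third gives
     the term depending on [mu]. *)
  exists (bad H (eta * lam) `|` bad K (c2 * lam) `|` bad K mu).
  split; first by apply: measurableU => //; exact: measurableU.
  split.
    move=> om /= le_mu; apply: contrapT => /not_orP[/not_orP[nH nK] nM].
    apply: nM; move: le_mu; rewrite supported; [|exact: notbad|exact: notbad].
    rewrite addrC addKr; exact: norminf_ge.
  apply: le_trans (measureU2 _ _ mM) _; first exact: measurableU.
  rewrite EFinD; apply: leeD.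
    apply: le_trans (measureU2 _ mH mK) _.
    apply: le_trans (leeD PH PK) _; rewrite expr1n mulr1 -EFinD lee_fin; lra.
  apply: le_trans PM _; rewrite lee_fin le_eqVlt; apply/orP; left; apply/eqP.
  rewrite mulrCA mulrA; congr (_ * expR _); field; rewrite !gt_eqF//.
have half0 : (0 : R) < 2^-1 by [].
have [mK PK] := tailK _ half0.
exists (~` (bad H (eta * lam) `|` bad K (2^-1 * (c2 * lam)))).
have mE := measurableU _ _ mH mK.
split; first exact: measurableC.
split.
  move=> om /= /not_orP[/notbad nH /notbad nK].
  have -> : thGL om = theta0 + K *m W om.
    by apply: supported => // i; apply: lt_trans (nK i) _; lra.
  (* True coefficients are at least [c2 * lam] and the error is below half of it, so half of it
     separates the entries. *)
  apply: (@Shat_threshold _ _ _ _ (2^-1 * (c2 * lam))) => i iS; rewrite mxE.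
    have := thS i iS; have := mulr_ge0 (ltW lam0) (normr_ge0 (w i 0)).
    have := lerB_normD (theta0 i 0) ((K *m W om) i 0); have := nK i; lra.
  have -> : theta0 i 0 = 0 by apply/eqP; move: iS; rewrite inE negbK.
  by rewrite add0r.
rewrite probability_setC// EFinB leeB//.
apply: le_trans (measureU2 _ mH mK) _; apply: le_trans (leeD PH PK) _.
have -> : c1 * 2^-1 ^+ 2 = c1 / 4 by field.
rewrite -EFinD lee_fin.
(* Both terms, of factor 2 each, are compared with the slower power; their sum is within the factor
   6. *)
have : (p%:R : R) `^ (1 - c1) <= p%:R `^ (1 - c1 / 4) by rewrite ler_powR//; lra.
have := pow_ge0 (1 - c1 / 4); lra.
Qed.
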